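(* Let $r\ge 2$ and $m = 2$. Let $a_{ij}\in\mathbb{C}$ ($1\le i\le 2$, $1\le j\le r$) and $f_i=\sum_{j=1}^r a_{ij}z_j$. Let $S_1$ be the family $(z_1^2,\dots,z_r^2,f_1^2,f_2^2)$ in $\mathbb{C}[z_1,\dots,z_r]$ and $S_2$ the family of all products of two distinct members of $S_1$. Then $S_2$ is linearly independent if and only if $S_1$ is linearly independent.
   Context: For a finite family $S_1=(p_1,\dots,p_l)$ of polynomials and $1\le k\le l$, $S_k$ denotes the family $(p_{i_1}p_{i_2}\cdots p_{i_k})_{1\le i_1<\dots<i_k\le l}$ of the $\binom{l}{k}$ products of $k$ members of $S_1$ with distinct indices. A family is linearly independent (over $\mathbb{C}$) if no nontrivial $\mathbb{C}$-linear combination of its members (counted with their indices, so repeated members make the family dependent) vanishes. *)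

(* Defs.v *)
From Stdlib Require Reals.
From mathcomp Require Import all_boot all_algebra.
From mathcomp Require Import complex.
From mathcomp Require Import Rstruct.
From mathcomp Require Import mpoly.

Set Implicit Arguments.
Unset Strict Implicit.
Unset Printing Implicit Defensive.
Import GRing.Theory.
Local Open Scope ring_scope.

Definition Cplx : Type := complex Rdefinitions.R.

Definition lin_indep (K : nzRingType) (V : lmodType K) (I : finType) (v : I -> V) : Prop :=
  forall c : I -> K, \sum_(i : I) c i *: v i = 0 -> forall i, c i = 0.

Definition S1fam (r : nat) (f1 f2 : {mpoly Cplx[r]}) (k : 'I_(r + 2)) : {mpoly Cplx[r]} :=
  match split k with
  | inl i => 'X_i ^+ 2
  | inr j => if nat_of_ord j == 0%N then f1 ^+ 2 else f2 ^+ 2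
  end.

Definition pair_idx (n : nat) := {p : 'I_n * 'I_n | (p.1 < p.2)%N}.

Definition S2fam (n : nat) (R : nzRingType) (S : 'I_n -> R) (p : pair_idx n) : R :=
  S (val p).1 * S (val p).2.

Definition linform (r : nat) (a : 'I_r -> Cplx) : {mpoly Cplx[r]} :=
  \sum_(j < r) a j *: 'X_j.

(* Main.v *)
Require Import Defs.
From Stdlib Require Reals.
From mathcomp Require Import all_boot all_order all_algebra.
From mathcomp Require Import complex.
From mathcomp Require Import Rstruct.
From mathcomp Require Import mpoly.
From mathcomp Require Import ring.

(* Write f_1 = sum a_j z_j and f_2 = sum b_j z_j. Up to the z_j^2, a relation in
   S_1 is a relation s a_i a_j + t b_i b_j = 0 for all i <> j, so S_1 is
   independent iff the off-diagonal parts of f_1^2 and f_2^2 are.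

   S_1 => S_2: in a relation among the members of S_2, let d_i, e_i, g be the
   coefficients of z_i^2 f_1^2, z_i^2 f_2^2, f_1^2 f_2^2, and compare
   coefficients of monomials other than z_i^2 z_j^2. If g <> 0, then
   a_i b_i <> 0 for some i would make the remainders f_1 - a_i z_i and
   f_2 - b_i z_i proportional, and then the z_i^2 z_j z_k terms force them to be
   monomials; so the supports of a and b are disjoint, and
   z_i z_j z_k z_l with i, j in one and k, l in the other yields g = 0. With
   g = 0, off-diagonal independence gives d_i = e_i = 0.

   S_2 => S_1: a relation in S_1 in which p does not occur gives one in S_2
   after multiplication by p. If every coefficient is nonzero and r >= 3, then
   s f_1^2 + t f_2^2 is a diagonal form of rank at least 3, which is impossible.
   For r = 2 the six products lie in the five-dimensional space of binary
   quartics. *)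

Set Implicit Arguments.
Unset Strict Implicit.
Unset Printing Implicit Defensive.
Import Order.TTheory GRing.Theory Num.Theory.
Local Open Scope ring_scope.

(** * Independence of [f_1^2] and [f_2^2] modulo the squares of the variables *)

Definition offdiag_indep (K : fieldType) (r : nat) (a b : 'I_r -> K) : Prop :=
  forall s t : K,
    (forall i j, i != j -> s * (a i * a j) + t * (b i * b j) = 0) ->
    s = 0 /\ t = 0.

Lemma offdiag_indepC (K : fieldType) (r : nat) (a b : 'I_r -> K) :
  offdiag_indep a b -> offdiag_indep b a.
Proof.
by move=> ab s t st; have [|-> ->] := ab t s => // i j /st <-; rewrite addrC.
Qed.

(** Otherwise [(s, t) = (1, 0)] would be a nontrivial relation. *)
Lemma offdiag_indep_neq0 (K : fieldType) (r : nat) (a b : 'I_r -> K) :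
  offdiag_indep a b -> exists i j, i != j /\ a i * a j != 0.
Proof.
move=> ab.
have [/existsP[i /existsP[j /andP[ij aij]]]|/existsPn a0] :=
  boolP [exists i, exists j, (i != j) && (a i * a j != 0)]; first by exists i, j.
have [|/eqP + _] := ab 1 0; last by rewrite oner_eq0.
move=> i j ij; have /existsPn/(_ j) := a0 i.
by rewrite ij negbK => /eqP ->; rewrite mulr0 mul0r addr0.
Qed.

(** * Solving the coefficient equations of a relation in [S_2] *)

Section Rigidity.
Variables (K : numFieldType) (r : nat) (a b d e : 'I_r -> K) (g : K).
Hypothesis ab : offdiag_indep a b.
(** The coefficients of [z_i^4], [z_i^3 z_j], [z_i^2 z_j z_k] and [z_i z_j z_k z_l], divided by 1,
    2, 2 and 4. *)
Hypothesis coef4 : forall i,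
  d i * a i ^+ 2 + e i * b i ^+ 2 + g * a i ^+ 2 * b i ^+ 2 = 0.
Hypothesis coef31 : forall i j, i != j ->
  d i * (a i * a j) + e i * (b i * b j)
  + g * (a i * a j * b i ^+ 2 + a i ^+ 2 * (b i * b j)) = 0.
Hypothesis coef211 : forall i j k, i != j -> i != k -> j != k ->
  d i * (a j * a k) + e i * (b j * b k)
  + g * (a i ^+ 2 * (b j * b k) + a j * a k * b i ^+ 2
         + 2 * (a i * b i) * (a j * b k + a k * b j)) = 0.
Hypothesis coef1111 : forall i j k l,
  i != j -> i != k -> i != l -> j != k -> j != l -> k != l ->
  g * (a i * a j * (b k * b l) + a i * a k * (b j * b l)
       + a i * a l * (b j * b k) + a j * a k * (b i * b l)
       + a j * a l * (b i * b k) + a k * a l * (b i * b j)) = 0.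

(* [P] and [Q] absorb the part of [g * f_1^2 * f_2^2] that looks like a
   multiple of [z_i^2 * f_1^2] or [z_i^2 * f_2^2]; the remaining cross term
   leaves the factor [3 = 4 - 1] in [Pt]. *)
Lemma rigidity_disjoint_supports (i : 'I_r) : g != 0 -> a i * b i = 0.
Proof.
move=> g0; apply/eqP/negPn/negP; rewrite mulf_eq0 negb_or => /andP[ai0 bi0].
pose P := d i + g * b i ^+ 2; pose Q := e i + g * a i ^+ 2.
have lin j : i != j -> a i * P * a j + b i * Q * b j = 0.
  by move=> /coef31 <-; rewrite /P /Q; ring.
have quad j k : i != j -> i != k -> j != k ->
    P * (a j * a k) + Q * (b j * b k)
    + 2 * g * (a i * b i) * (a j * b k + a k * b j) = 0.
  by move=> ij ik jk; rewrite -(coef211 ij ik jk) /P /Q; ring.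
have PQ : a i * (a i * P) + b i * (b i * Q) = g * a i ^+ 2 * b i ^+ 2.
  by rewrite -[RHS]addr0 -(coef4 i) /P /Q; ring.
have PQ0 : g * a i ^+ 2 * b i ^+ 2 != 0 by rewrite !mulf_neq0 ?expf_neq0.
(* If [P = 0], then [lin] leaves [b] supported at [i] alone; [Q = 0] does the same to [a]. *)
have P0 : P != 0.
  apply/eqP => P0; have Q0 : b i * Q != 0.
    by apply: contraNneq PQ0 => Q0; rewrite -PQ P0 Q0 !mulr0 addr0.
  have b0 j : i != j -> b j = 0.
    move=> /lin; rewrite P0 mulr0 mul0r add0r => /eqP.
    by rewrite mulf_eq0 (negbTE Q0) => /eqP.
  have [j [k [jk]]] := offdiag_indep_neq0 (offdiag_indepC ab).
  have [ij|/b0->] := eqVneq i j; last by rewrite mul0r eqxx.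
  by rewrite (b0 k) ?mulr0 ?eqxx // ij.
have Q0 : Q != 0.
  apply/eqP => Q0.
  have a0 j : i != j -> a j = 0.
    move=> /lin; rewrite Q0 mulr0 mul0r addr0 => /eqP.
    by rewrite !mulf_eq0 (negbTE ai0) (negbTE P0) => /eqP.
  have [j [k [jk]]] := offdiag_indep_neq0 ab.
  have [ij|/a0->] := eqVneq i j; last by rewrite mul0r eqxx.
  by rewrite (a0 k) ?mulr0 ?eqxx // ij.
(* By [lin], the factor with [f_1 - a_i z_i = t (f_2 - b_i z_i)]. *)
pose t := - (b i * Q) / (a i * P).
have t0 : t != 0 by rewrite /t mulf_neq0 ?oppr_eq0 ?invr_eq0 ?mulf_neq0.
have at_ j : i != j -> a j = t * b j.
  move=> /lin/eqP; rewrite addr_eq0 => /eqP aj.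
  apply: (mulfI (mulf_neq0 ai0 P0)); rewrite aj /t; field.
  by rewrite ai0 P0.
have tP : b i * Q = - t * (a i * P) by rewrite /t; field; rewrite ai0 P0.
clearbody t.
have Pt : (P * t ^+ 2 + Q + 4 * g * (a i * b i) * t) = 3 * t * (g * a i * b i).
  apply: (mulfI (mulf_neq0 ai0 bi0)).
  transitivity (3 * t * (g * a i ^+ 2 * b i ^+ 2)); last by ring.
  transitivity (b i * t ^+ 2 * (a i * P) + a i * (b i * Q)
                + 4 * t * (g * a i ^+ 2 * b i ^+ 2)); first by ring.
  by rewrite -PQ tP; ring.
have bb j k : i != j -> i != k -> j != k -> b j * b k = 0.
  move=> ij ik jk; have := quad j k ij ik jk; rewrite (at_ j ij) (at_ k ik).
  have -> : P * (t * b j * (t * b k)) + Q * (b j * b k)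
     + 2 * g * (a i * b i) * (t * b j * b k + t * b k * b j)
     = (P * t ^+ 2 + Q + 4 * g * (a i * b i) * t) * (b j * b k) by ring.
  rewrite Pt => /eqP; rewrite mulf_eq0 => /orP[|/eqP //].
  by rewrite !mulf_eq0 pnatr_eq0 (negbTE t0) (negbTE g0) (negbTE ai0) (negbTE bi0).
(* These weights cancel the pairs containing [i]; [bb] handles the others. *)
have [|/eqP + _] := @ab (b i) (- (a i * t)); last by rewrite (negbTE bi0).
move=> j k jk; have [ij|ij] := eqVneq i j.
  by rewrite -ij (at_ k) ?ij //; ring.
have [ik|ik] := eqVneq i k; first by rewrite -ik (at_ j) //; ring.
rewrite (at_ j) // (at_ k) //.
transitivity ((b i * t ^+ 2 - a i * t) * (b j * b k)); first by ring.
by rewrite bb ?mulr0.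
Qed.

Lemma rigidity_g0 : g = 0.
Proof.
apply/eqP/negPn/negP => g0.
have disj i := rigidity_disjoint_supports i g0.
have b0 i : a i != 0 -> b i = 0.
  by move=> ai; apply/eqP; move/eqP: (disj i); rewrite mulf_eq0 (negbTE ai).
have [i [j [ij]]] := offdiag_indep_neq0 ab.
have [k [l [kl]]] := offdiag_indep_neq0 (offdiag_indepC ab).
rewrite !mulf_eq0 !negb_or => /andP[bk bl] /andP[ai aj].
have neq p q : a p != 0 -> b q != 0 -> p != q.
  by move=> ap; apply: contraNneq => <-; rewrite b0.
have := coef1111 ij (neq _ _ ai bk) (neq _ _ ai bl)
  (neq _ _ aj bk) (neq _ _ aj bl) kl.
rewrite (b0 i) // (b0 j) // !(mul0r, mulr0, addr0) => /eqP.
by rewrite !mulf_eq0 (negbTE g0) (negbTE ai) (negbTE aj) (negbTE bk) (negbTE bl).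
Qed.

(** Once [g = 0], [(d i, e i)] is an off-diagonal relation: [coef31] covers the pairs containing
    [i], [coef211] the rest. *)
Lemma rigidity_de0 (i : 'I_r) : d i = 0 /\ e i = 0.
Proof.
have g0 := rigidity_g0; apply: ab => j k jk.
have [ij|ij] := eqVneq i j.
  by have := @coef31 i k; rewrite g0 mul0r addr0 -ij; apply; rewrite ij.
have [ik|ik] := eqVneq i k.
  have := @coef31 i j; rewrite g0 mul0r addr0 -ik => /(_ ij) <-.
  by rewrite [a j * _]mulrC [b j * _]mulrC.
by have := coef211 ij ik jk; rewrite g0 mul0r addr0.
Qed.

End Rigidity.

(** * Coefficients obtained from values at points with at most four nonzero coordinates *)

Section PointEvaluation.
Variables (K : numFieldType) (r : nat).

(** Four slots serve every monomial type; a surplus slot repeats an index with weight 0. *)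
Definition point4 (i j k l : 'I_r) (x y z w : K) (n : 'I_r) : K :=
  x * (n == i)%:R + y * (n == j)%:R + z * (n == k)%:R + w * (n == l)%:R.

Lemma sum_point4 (i j k l : 'I_r) (x y z w : K) (F : 'I_r -> K) :
  \sum_n F n * point4 i j k l x y z w n = F i * x + F j * y + F k * z + F l * w.
Proof.
have sum1 (u : 'I_r) (s : K) : \sum_n F n * (s * (n == u)%:R) = F u * s.
  rewrite (bigD1 u) //= eqxx mulr1 big1 ?addr0 // => n /negbTE ->.
  by rewrite !mulr0.
by under eq_bigr do rewrite /point4 !mulrDr; rewrite !big_split /= !sum1.
Qed.

(** Exactly what makes the cross term of two slots vanish when [point4] is squared. *)
Definition compatible (i j : 'I_r) (x y : K) := (i != j) || (x * y == 0).

Lemma compatible_cross (i j n : 'I_r) (x y : K) :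
  compatible i j x y -> (x * (n == i)%:R) * (y * (n == j)%:R) = 0.
Proof.
rewrite /compatible; have [<-|_ _] := eqVneq n i; last by rewrite mulr0 mul0r.
have [_|_ _] := eqVneq n j; last by rewrite !mulr0.
by move=> /eqP xy; rewrite !mulr1.
Qed.

Lemma point4_sqr (i j k l n : 'I_r) (x y z w : K) :
  compatible i j x y -> compatible i k x z -> compatible i l x w ->
  compatible j k y z -> compatible j l y w -> compatible k l z w ->
  point4 i j k l x y z w n ^+ 2
  = point4 i j k l (x ^+ 2) (y ^+ 2) (z ^+ 2) (w ^+ 2) n.
Proof.
move=> /(compatible_cross n) ij /(compatible_cross n) ik.
move=> /(compatible_cross n) il /(compatible_cross n) jk.
move=> /(compatible_cross n) jl /(compatible_cross n) kl.
have idem (u : 'I_r) (s : K) : (s * (n == u)%:R) ^+ 2 = s ^+ 2 * (n == u)%:R.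
  by case: (n == u); rewrite ?mulr1 ?mulr0 ?expr0n.
rewrite /point4 -!idem; move: ij ik il jk jl kl.
move: (x * _) (y * _) (z * _) (w * _) => X Y Z W XY XZ XW YZ YW ZW.
transitivity (X ^+ 2 + Y ^+ 2 + Z ^+ 2 + W ^+ 2
  + 2 * (X * Y + X * Z + X * W + Y * Z + Y * W + Z * W)); first by ring.
by rewrite XY XZ XW YZ YW ZW !addr0 mulr0 addr0.
Qed.

Variables (a b d e : 'I_r -> K) (C : 'I_r -> 'I_r -> K) (g : K).
Hypothesis C_upper : forall i j : 'I_r, ~~ (i < j)%N -> C i j = 0.
Hypothesis vanish : forall v : 'I_r -> K,
  let A := \sum_n a n * v n in let B := \sum_n b n * v n in
  \sum_i \sum_j C i j * (v i ^+ 2 * v j ^+ 2)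
  + \sum_i d i * (v i ^+ 2 * A ^+ 2) + \sum_i e i * (v i ^+ 2 * B ^+ 2)
  + g * (A ^+ 2 * B ^+ 2) = 0.

(** The part from the [z_m^2 z_n^2], to be fed squared coordinates and hence blind to their signs;
    [Phi] collects the other terms. *)
Let Q (i j k l : 'I_r) (x y z w : K) :=
  \sum_m (\sum_n C m n * point4 i j k l x y z w n) * point4 i j k l x y z w m.

Let Phi (i j k l : 'I_r) (x y z w : K) :=
  (d i * x ^+ 2 + d j * y ^+ 2 + d k * z ^+ 2 + d l * w ^+ 2)
    * (a i * x + a j * y + a k * z + a l * w) ^+ 2
  + (e i * x ^+ 2 + e j * y ^+ 2 + e k * z ^+ 2 + e l * w ^+ 2)
    * (b i * x + b j * y + b k * z + b l * w) ^+ 2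
  + g * ((a i * x + a j * y + a k * z + a l * w) ^+ 2
         * (b i * x + b j * y + b k * z + b l * w) ^+ 2).

Lemma vanish_point4 (i j k l : 'I_r) (x y z w : K) :
  compatible i j x y -> compatible i k x z -> compatible i l x w ->
  compatible j k y z -> compatible j l y w -> compatible k l z w ->
  Phi i j k l x y z w = - Q i j k l (x ^+ 2) (y ^+ 2) (z ^+ 2) (w ^+ 2).
Proof.
move=> ij ik il jk jl kl; apply/eqP; rewrite -addr_eq0 addrC; apply/eqP.
have sqr n := point4_sqr n ij ik il jk jl kl.
have sum_sqr (F : 'I_r -> K) c :
    \sum_n F n * (point4 i j k l x y z w n ^+ 2 * c)
    = (F i * x ^+ 2 + F j * y ^+ 2 + F k * z ^+ 2 + F l * w ^+ 2) * c.
  by under eq_bigr do rewrite sqr mulrA; rewrite -mulr_suml sum_point4.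
rewrite -(vanish (point4 i j k l x y z w)) /= !sum_point4 !sum_sqr.
rewrite /Phi !addrA; congr (_ + _ + _ + _).
apply: eq_bigr => m _; rewrite mulr_suml; apply: eq_bigr => n _.
by rewrite !sqr mulrAC mulrA.
Qed.

Lemma vanish_coef4 (i : 'I_r) :
  d i * a i ^+ 2 + e i * b i ^+ 2 + g * a i ^+ 2 * b i ^+ 2 = 0.
Proof.
have : Phi i i i i 1 0 0 0 = - Q i i i i (1 ^+ 2) (0 ^+ 2) (0 ^+ 2) (0 ^+ 2).
  by apply: vanish_point4; rewrite /compatible ?mulr0 ?eqxx ?orbT.
rewrite /Q !sum_point4 C_upper ?ltnn // /Phi !(expr0n, expr1n) /=.
by rewrite !(mul0r, mulr0, mulr1, addr0, oppr0) mulrA.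
Qed.

(* The terms in [C], even in each coordinate, cancel in differences under sign
   changes, which isolate the monomials odd in the chosen coordinates. *)
Lemma vanish_coef31 (i j : 'I_r) : i != j ->
  d i * (a i * a j) + e i * (b i * b j)
  + g * (a i * a j * b i ^+ 2 + a i ^+ 2 * (b i * b j)) = 0.
Proof.
move=> ij; have PhiQ y :
    Phi i j i i 1 y 0 0 = - Q i j i i (1 ^+ 2) (y ^+ 2) (0 ^+ 2) (0 ^+ 2).
  by apply: vanish_point4; rewrite /compatible ?ij ?mulr0 ?eqxx ?orbT.
have n0 : 24%:R != 0 :> K by rewrite pnatr_eq0.
apply: (mulfI n0); rewrite mulr0.
(* The part odd in [y] is [c_1 y + c_3 y^3]; the weights 8 and -1 at [y = 1, 2] eliminate [c_3] and
   leave [12 c_1], where [c_1] is twice the expression sought. *)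
transitivity (8 * (Phi i j i i 1 1 0 0 - Phi i j i i 1 (-1) 0 0)
              - (Phi i j i i 1 2 0 0 - Phi i j i i 1 (-2) 0 0)).
  by rewrite /Phi; ring.
by rewrite !PhiQ !sqrrN !subrr mulr0 subr0.
Qed.

Lemma vanish_coef211 (i j k : 'I_r) : i != j -> i != k -> j != k ->
  d i * (a j * a k) + e i * (b j * b k)
  + g * (a i ^+ 2 * (b j * b k) + a j * a k * b i ^+ 2
         + 2 * (a i * b i) * (a j * b k + a k * b j)) = 0.
Proof.
move=> ij ik jk; have PhiQ y z :
    Phi i j k i 1 y z 0 = - Q i j k i (1 ^+ 2) (y ^+ 2) (z ^+ 2) (0 ^+ 2).
  by apply: vanish_point4; rewrite /compatible ?ij ?ik ?jk ?mulr0 ?eqxx ?orbT.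
have n0 : 8%:R != 0 :> K by rewrite pnatr_eq0.
have kj : k != j by rewrite eq_sym.
apply: (mulfI n0); rewrite mulr0.
(* The double sign difference also retains [y^3 z] and [y z^3], which are subtracted as instances of
   [vanish_coef31]. *)
transitivity (Phi i j k i 1 1 1 0 - Phi i j k i 1 (-1) 1 0
    - (Phi i j k i 1 1 (-1) 0 - Phi i j k i 1 (-1) (-1) 0)
  - 8 * (d j * (a j * a k) + e j * (b j * b k)
    + g * (a j * a k * b j ^+ 2 + a j ^+ 2 * (b j * b k)))
  - 8 * (d k * (a k * a j) + e k * (b k * b j)
    + g * (a k * a j * b k ^+ 2 + a k ^+ 2 * (b k * b j)))).
  by rewrite /Phi; ring.
by rewrite !PhiQ !sqrrN !vanish_coef31 // !subrr !mulr0 !subr0.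
Qed.

Lemma vanish_coef1111 (i j k l : 'I_r) :
  i != j -> i != k -> i != l -> j != k -> j != l -> k != l ->
  g * (a i * a j * (b k * b l) + a i * a k * (b j * b l)
       + a i * a l * (b j * b k) + a j * a k * (b i * b l)
       + a j * a l * (b i * b k) + a k * a l * (b i * b j)) = 0.
Proof.
move=> ij ik il jk jl kl; have PhiQ y z w :
    Phi i j k l 1 y z w = - Q i j k l (1 ^+ 2) (y ^+ 2) (z ^+ 2) (w ^+ 2).
  by apply: vanish_point4; rewrite /compatible ?ij ?ik ?il ?jk ?jl ?kl.
have n0 : 32%:R != 0 :> K by rewrite pnatr_eq0.
apply: (mulfI n0); rewrite mulr0.
(* In degree 4 only [x y z w] is odd in all of [y], [z], [w]; 32 is 8 sign choices times the factor
   4 in its coefficient. *)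
transitivity ((Phi i j k l 1 1 1 1 - Phi i j k l 1 (-1) 1 1
    - (Phi i j k l 1 1 (-1) 1 - Phi i j k l 1 (-1) (-1) 1))
  - ((Phi i j k l 1 1 1 (-1) - Phi i j k l 1 (-1) 1 (-1))
    - (Phi i j k l 1 1 (-1) (-1) - Phi i j k l 1 (-1) (-1) (-1)))).
  by rewrite /Phi; ring.
by rewrite !PhiQ !sqrrN !subrr.
Qed.

Lemma vanish_rigidity : offdiag_indep a b ->
  [/\ forall i j, C i j = 0, forall i, d i = 0, forall i, e i = 0 & g = 0].
Proof.
move=> ab.
have g0 := rigidity_g0 ab vanish_coef4 vanish_coef31 vanish_coef211 vanish_coef1111.
have de0 := rigidity_de0 ab vanish_coef4 vanish_coef31 vanish_coef211 vanish_coef1111.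
have d0 i : d i = 0 by have [] := de0 i.
have e0 i : e i = 0 by have [] := de0 i.
split => // i j; have [ij|ij] := boolP (i < j)%N; last exact: C_upper.
have nij : i != j by apply: contraTneq ij => ->; rewrite ltnn.
(* With [d], [e], [g] zero, this point sees only [C i j]. *)
have : Phi i j i i 1 1 0 0 = - Q i j i i (1 ^+ 2) (1 ^+ 2) (0 ^+ 2) (0 ^+ 2).
  by apply: vanish_point4; rewrite /compatible ?nij ?mulr0 ?eqxx ?orbT.
rewrite /Q !sum_point4 /Phi !d0 !e0 g0 !(expr0n, expr1n) /=.
rewrite (C_upper (i := i) (j := i)) ?ltnn // (C_upper (i := j) (j := j)) ?ltnn //.
rewrite (C_upper (i := j) (j := i)) -?leqNgt 1?ltnW //.
by rewrite !(mul0r, mulr0, mulr1, addr0, add0r) => /esym/eqP; rewrite oppr_eq0 => /eqP.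
Qed.

End PointEvaluation.

(** * Sums over increasing pairs and relations among products *)

Section PairSums.
Variable n : nat.

Lemma sum_pair_idx (V : nmodType) (F : 'I_n * 'I_n -> V) :
  \sum_(p : pair_idx n) F (val p) = \sum_(i < n) \sum_(j < n | (i < j)%N) F (i, j).
Proof.
rewrite pair_big_dep /= (reindex_omap (val : pair_idx n -> _) insub) /=.
  apply: eq_big => [p|p _]; last by case: (val p).
  by rewrite valK eqxx andbT (valP p).
by move=> p pP; rewrite insubT /=.
Qed.

Definition pair_ext (K : nmodType) (c : pair_idx n -> K) (i j : 'I_n) : K :=
  oapp c 0 (insub (i, j)).

Lemma pair_extE (K : nmodType) (c : pair_idx n -> K) (p : pair_idx n) :
  pair_ext c (val p).1 (val p).2 = c p.
Proof. by rewrite /pair_ext -surjective_pairing valK. Qed.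

Lemma pair_ext0 (K : nmodType) (c : pair_idx n -> K) (i j : 'I_n) :
  ~~ (i < j)%N -> pair_ext c i j = 0.
Proof. by move=> ij; rewrite /pair_ext insubN. Qed.

Lemma sum_pair_ext (K : nzRingType) (A : lmodType K) (c : pair_idx n -> K)
    (F : 'I_n -> 'I_n -> A) :
  \sum_(p : pair_idx n) c p *: F (val p).1 (val p).2
  = \sum_(i < n) \sum_(j < n) pair_ext c i j *: F i j.
Proof.
under eq_bigr do rewrite -(pair_extE c).
rewrite (sum_pair_idx (fun q => pair_ext c q.1 q.2 *: F q.1 q.2)) /=.
apply: eq_bigr => i _; rewrite big_mkcond; apply: eq_bigr => j _.
by case: ifPn => // ij; rewrite pair_ext0 // scale0r.
Qed.

Variables (K : fieldType) (A : comAlgType K) (S : 'I_n -> A).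
Hypothesis S2_indep : lin_indep (S2fam S).

Lemma S2_indep_pairs (M : 'I_n -> 'I_n -> K) :
  \sum_(i < n) \sum_(j < n | (i < j)%N) M i j *: (S i * S j) = 0 ->
  forall i j : 'I_n, (i < j)%N -> M i j = 0.
Proof.
move=> M0 i j ij.
pose c (p : pair_idx n) := M (val p).1 (val p).2.
suff c0 : \sum_p c p *: S2fam S p = 0 by exact: (S2_indep c0 (Sub (i, j) ij)).
rewrite -[RHS]M0.
exact: (sum_pair_idx (fun q => M q.1 q.2 *: (S q.1 * S q.2))).
Qed.

(* Multiplying the relation by [S p] yields a relation among products of
   distinct members precisely because [S p] itself does not occur in it. *)
Lemma S2_indep_relation (c : 'I_n -> K) (p : 'I_n) :
  \sum_k c k *: S k = 0 -> c p = 0 -> forall k, c k = 0.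
Proof.
move=> rel cp.
(* [S p * S k] is indexed by [(p, k)] or [(k, p)] according to the order; the two summands cover
   these cases. *)
pose M i j := c j *+ (i == p) + c i *+ (j == p).
have M0 : \sum_(i < n) \sum_(j < n | (i < j)%N) M i j *: (S i * S j) = 0.
  transitivity (S p * \sum_k c k *: S k); last by rewrite rel mulr0.
  under eq_bigr do under eq_bigr do rewrite scalerDl.
  under eq_bigr do rewrite big_split /=.
  rewrite big_split /= (bigD1 p) //= [X in _ + X + _]big1 ?addr0; last first.
    by move=> i /negbTE ip; apply: big1 => j _; rewrite ip mulr0n scale0r.
  rewrite (exchange_big_dep predT) //= [X in _ + X](bigD1 p) //=.
  rewrite [X in _ + (_ + X)]big1 ?addr0; last first.
    by move=> i /negbTE ip; apply: big1 => j _; rewrite ip mulr0n scale0r.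
  rewrite mulr_sumr [RHS](bigD1 p) //= cp scale0r mulr0 add0r.
  rewrite [RHS](bigID (fun k : 'I_n => (p < k)%N)) /=; congr (_ + _).
    apply: eq_big => [k|k _]; last by rewrite eqxx mulr1n scalerAr.
    by case: (ltngtP p k) => [pk|pk|/val_inj ->]; rewrite ?andbF ?eqxx // andbT;
      apply/esym; apply: contraTneq pk => ->; rewrite ltnn.
  apply: eq_big => [k|k _]; last by rewrite eqxx mulr1n mulrC scalerAr.
  case: (ltngtP k p) => [kp|kp|/val_inj ->]; rewrite ?andbF ?eqxx // andbT.
  by apply/esym; apply: contraTneq kp => ->; rewrite ltnn.
move=> k; case: (ltngtP p k) => [pk|kp|/val_inj <- //].
  by have := S2_indep_pairs M0 pk; rewrite /M eqxx cp mul0rn addr0.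
by have := S2_indep_pairs M0 kp; rewrite /M eqxx cp mul0rn add0r.
Qed.

End PairSums.

(** * Relations in [S_1] and [S_2] for two linear forms *)

Section Polynomials.
Variables (r : nat) (a b : 'I_r -> Cplx).
Let S1 := S1fam (linform a) (linform b).

Lemma S1fam_l (i : 'I_r) : S1 (lshift 2 i) = 'X_i ^+ 2.
Proof. by rewrite /S1 /S1fam (unsplitK (inl i)). Qed.

Lemma S1fam_r0 : S1 (rshift r 0) = linform a ^+ 2.
Proof. by rewrite /S1 /S1fam (unsplitK (inr 0)). Qed.

Lemma S1fam_r1 : S1 (rshift r 1) = linform b ^+ 2.
Proof. by rewrite /S1 /S1fam (unsplitK (inr 1)). Qed.

Definition S1fam_E := (S1fam_l, S1fam_r0, S1fam_r1).

Lemma sum_split_ord2 (V : nmodType) (F : 'I_(r + 2) -> V) :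
  \sum_k F k = \sum_i F (lshift 2 i) + F (rshift r 0) + F (rshift r 1).
Proof.
rewrite big_split_ord /= !big_ord_recl big_ord0 addr0 addrA.
by congr (_ + F (rshift r _)); apply/val_inj.
Qed.

Lemma forall_split_ord2 (P : 'I_(r + 2) -> Prop) :
  (forall i, P (lshift 2 i)) -> P (rshift r 0) -> P (rshift r 1) -> forall k, P k.
Proof.
move=> Pl P0 P1 k; case: (split_ordP k) => [i ->|j ->]; first exact: Pl.
by case: j => [[|[|//]] lt_j]; [have -> : Ordinal lt_j = 0 by apply/val_inj
  | have -> : Ordinal lt_j = 1 by apply/val_inj].
Qed.

Lemma meval_linform (f v : 'I_r -> Cplx) :
  (linform f).@[v] = \sum_n f n * v n.
Proof.
by rewrite /linform raddf_sum /=; apply: eq_bigr => i _; rewrite mevalZ mevalXU.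
Qed.

(** The conditions are the coefficients of [z_i^2] and, halved, of [z_i z_j]. *)
Lemma sum_S1 (c : 'I_(r + 2) -> Cplx) :
  \sum_k c k *: S1 k = 0 <->
  (forall i, c (lshift 2 i) + c (rshift r 0) * a i ^+ 2
             + c (rshift r 1) * b i ^+ 2 = 0) /\
  (forall i j, i != j ->
     c (rshift r 0) * (a i * a j) + c (rshift r 1) * (b i * b j) = 0).
Proof.
rewrite sum_split_ord2; under eq_bigr do rewrite S1fam_l.
rewrite S1fam_r0 S1fam_r1; set s := c _; set t := c _.
split=> [rel|[diag off]]; last first.
  have sqr (f : 'I_r -> Cplx) u : u *: linform f ^+ 2
      = \sum_i \sum_j (u * (f i * f j)) *: ('X_i * 'X_j).
    rewrite /linform expr2 big_distrlr scaler_sumr; apply: eq_bigr => i _.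
    rewrite scaler_sumr; apply: eq_bigr => j _.
    by rewrite /= -scalerAl -scalerAr !scalerA mulrA.
  rewrite !sqr -!big_split /= big1 // => i _; rewrite -addrA -big_split /=.
  rewrite (bigD1 i) //= big1 ?addr0 => [|j ji].
    by rewrite -!scalerDl -!expr2 addrA diag scale0r.
  by rewrite -scalerDl off 1?eq_sym // scale0r.
pose psi (v : 'I_r -> Cplx) := \sum_n c (lshift 2 n) * v n ^+ 2
  + s * (\sum_n a n * v n) ^+ 2 + t * (\sum_n b n * v n) ^+ 2.
have psi0 v : psi v = 0.
  have := congr1 (meval v) rel.
  rewrite meval0 !mevalD !mevalZ !expr2 !mevalM !meval_linform -!expr2 => <-.
  rewrite raddf_sum /=; congr (_ + _ + _); apply: eq_bigr => n _.
  by rewrite mevalZ expr2 mevalM mevalXU.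
have point i j (y : Cplx) : i != j ->
    c (lshift 2 i) + c (lshift 2 j) * y ^+ 2
    + s * (a i + a j * y) ^+ 2 + t * (b i + b j * y) ^+ 2 = 0.
  move=> ij; rewrite -(psi0 (point4 i j i i 1 y 0 0)) /psi !sum_point4.
  under eq_bigr do
    rewrite point4_sqr /compatible ?ij ?mulr0 ?mul0r ?eqxx ?orbT //.
  by rewrite sum_point4 !(expr1n, expr0n) /= !(mulr0, mulr1, addr0).
have n0 : 4%:R != 0 :> Cplx by rewrite pnatr_eq0.
split=> [i|i j ij].
  rewrite -(psi0 (point4 i i i i 1 0 0 0)) /psi !sum_point4.
  under eq_bigr do rewrite point4_sqr /compatible ?mulr0 ?mul0r ?eqxx ?orbT //.
  by rewrite sum_point4 !(expr1n, expr0n) /= !(mulr0, mulr1, addr0).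
(* The values at [y = 1] and [y = -1] differ by four times the cross term. *)
apply: (mulfI n0); rewrite mulr0 -[RHS](subrr 0) -{1}(point i j 1 ij).
by rewrite -(point i j (-1) ij); ring.
Qed.

Definition S1_coef (d : 'I_r -> Cplx) (s t : Cplx) (k : 'I_(r + 2)) : Cplx :=
  match split k with
  | inl i => d i
  | inr j => if nat_of_ord j == 0%N then s else t
  end.

Lemma S1_coefE (d : 'I_r -> Cplx) (s t : Cplx) :
  [/\ forall i, S1_coef d s t (lshift 2 i) = d i,
      S1_coef d s t (rshift r 0) = s & S1_coef d s t (rshift r 1) = t].
Proof.
by split=> [i||]; rewrite /S1_coef ?(unsplitK (inl i)) ?(unsplitK (inr 0))
  ?(unsplitK (inr 1)).
Qed.

(** The coefficients of the [z_i^2] are free to absorb the diagonal. *)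
Lemma S1_coef_relation (s t : Cplx) :
  (forall i j, i != j -> s * (a i * a j) + t * (b i * b j) = 0) ->
  \sum_k S1_coef (fun i => - (s * a i ^+ 2 + t * b i ^+ 2)) s t k *: S1 k = 0.
Proof.
move=> off; apply/sum_S1.
have [El -> ->] := S1_coefE (fun i => - (s * a i ^+ 2 + t * b i ^+ 2)) s t.
by split=> // i; rewrite El -addrA addNr.
Qed.

Lemma S1_indep_offdiag : lin_indep S1 -> offdiag_indep a b.
Proof.
move=> indep s t /S1_coef_relation/indep coef0.
have [_ E0 E1] := S1_coefE (fun i => - (s * a i ^+ 2 + t * b i ^+ 2)) s t.
by split; [rewrite -E0 | rewrite -E1]; apply: coef0.
Qed.

(** The condition at [p] removes [z_p^2] from the lifted relation, so that multiplying by [z_p^2]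
    lands in [S_2]. *)
Lemma S2_indep_offdiag (s t : Cplx) (p : 'I_r) :
  lin_indep (S2fam S1) ->
  (forall i j, i != j -> s * (a i * a j) + t * (b i * b j) = 0) ->
  s * a p ^+ 2 + t * b p ^+ 2 = 0 -> s = 0 /\ t = 0.
Proof.
move=> indep /S1_coef_relation rel stp.
have [El E0 E1] := S1_coefE (fun i => - (s * a i ^+ 2 + t * b i ^+ 2)) s t.
have coef0 := S2_indep_relation indep rel (p := lshift 2 p).
by split; [rewrite -E0 | rewrite -E1]; apply: coef0; rewrite El stp oppr0.
Qed.

Lemma S1_indep_S2 : lin_indep S1 -> lin_indep (S2fam S1).
Proof.
move=> /S1_indep_offdiag ab c.
rewrite (sum_pair_ext c (fun i j => S1 i * S1 j)) => rel.
set C := pair_ext c in rel *.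
have C0 (i j : 'I_(r + 2)) : ~~ (i < j)%N -> C i j = 0 by exact: pair_ext0.
(* The forms are indexed after the variables, so such a pair is decreasing. *)
have Crl i j : C (rshift r i) (lshift 2 j) = 0.
  by apply: C0; rewrite -leqNgt /= ltnW // ltn_addr.
have [] := @vanish_rigidity _ r a b (fun i => C (lshift 2 i) (rshift r 0))
  (fun i => C (lshift 2 i) (rshift r 1)) (fun i j => C (lshift 2 i) (lshift 2 j))
  (C (rshift r 0) (rshift r 1)) _ _ ab.
- by move=> i j ij; apply: C0.
- move=> v A B; pose ev k := (S1 k).@[v].
  have evX i : ev (lshift 2 i) = v i ^+ 2.
    by rewrite /ev S1fam_l expr2 mevalM mevalXU.
  have ev0 : ev (rshift r 0) = A ^+ 2.
    by rewrite /ev S1fam_r0 expr2 mevalM meval_linform.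
  have ev1 : ev (rshift r 1) = B ^+ 2.
    by rewrite /ev S1fam_r1 expr2 mevalM meval_linform.
  have : \sum_i \sum_j C i j * (ev i * ev j) = 0.
    rewrite -[RHS](meval0 v) -rel raddf_sum /=; apply: eq_bigr => i _.
    by rewrite raddf_sum /=; apply: eq_bigr => j _; rewrite mevalZ mevalM.
  under eq_bigr do rewrite sum_split_ord2.
  rewrite sum_split_ord2 !big_split /= ev0 ev1.
  have Z j u : \sum_i C (rshift r j) (lshift 2 i) * (u * ev (lshift 2 i)) = 0.
    by apply: big1 => i _; rewrite Crl mul0r.
  rewrite !Z (C0 (rshift r 0) (rshift r 0)) ?ltnn //.
  rewrite (C0 (rshift r 1) (rshift r 0)) /= ?ltn_add2l // (C0 (rshift r 1) (rshift r 1)) ?ltnn //.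
  rewrite !mul0r !addr0 !add0r => ev_rel; rewrite -[RHS]ev_rel; congr (_ + _ + _ + _).
  - by apply: eq_bigr => i _; apply: eq_bigr => j _; rewrite !evX.
  - by apply: eq_bigr => i _; rewrite evX.
  by apply: eq_bigr => i _; rewrite evX.
move=> Cll C0r C1r C01 p.
rewrite -(pair_extE c) -/C.
move: (val p).1 (val p).2.
apply: forall_split_ord2 => [i||]; apply: forall_split_ord2 => [j||] //;
  try exact: Crl; by apply: C0; rewrite -leqNgt ?leqnn //= leq_add2l.
Qed.

Lemma S2_indep_S1 : (2 < r)%N -> lin_indep (S2fam S1) -> lin_indep S1.
Proof.
move=> r2 indep c rel.
have [/existsP[p /eqP cp]|/existsPn c0] := boolP [exists p, c p == 0].
  exact: (S2_indep_relation indep rel cp).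
have [diag off] := proj1 (sum_S1 c) rel.
pose i := Ordinal (ltnW (ltnW r2)); pose j := Ordinal (ltnW r2); pose k := Ordinal r2.
have ij := off i j isT; have ik := off i k isT; have jk := off j k isT.
have cl n : c (lshift 2 n)
    = - (c (rshift r 0) * a n ^+ 2 + c (rshift r 1) * b n ^+ 2).
  by apply/eqP; rewrite -addr_eq0 addrA diag.
suff : c (lshift 2 i) * c (lshift 2 j) * c (lshift 2 k) = 0.
  by move/eqP; rewrite !mulf_eq0 !(negbTE (c0 _)).
rewrite !cl; move: ij ik jk; set s := c _; set t := c _.
set m := _ + _ => m0; set n := _ + _ => n0; set o := _ + _ => o0.
(* The 3x3 minor of the rank-two form [s * f_1^2 + t * f_2^2] vanishes. *)
transitivity (2 * m * n * o - (s * a i ^+ 2 + t * b i ^+ 2) * o ^+ 2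
  - (s * a j ^+ 2 + t * b j ^+ 2) * n ^+ 2
  - (s * a k ^+ 2 + t * b k ^+ 2) * m ^+ 2); first by rewrite /m /n /o; ring.
by rewrite m0 n0 o0 !expr0n /= !mulr0 !subr0.
Qed.

End Polynomials.

(** * Two variables, and the equivalence *)

Lemma S2_dep_binary (a b : 'I_2 -> Cplx) :
  ~ lin_indep (S2fam (S1fam (linform a) (linform b))).
Proof.
move=> indep.
pose a0 := a ord0; pose a1 := a (lift ord0 ord0).
pose b0 := b ord0; pose b1 := b (lift ord0 ord0).
pose D := a0 * b1 - a1 * b0.
(* Coefficients of a relation among the pairs of (z_1^2, z_2^2, f_1^2, f_2^2),
   valid for all forms and nontrivial when their determinant [D] is nonzero. *)
pose tbl : seq (seq Cplx) :=
  [:: [:: 0; D ^+ 3; a1 * b0 ^+ 3; - (a0 ^+ 3 * b1)];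
      [:: 0; 0; - (a0 * b1 ^+ 3); a1 ^+ 3 * b0];
      [:: 0; 0; 0; D]].
pose M (i j : 'I_(2 + 2)) := nth 0 (nth [::] tbl i) j.
(* [D] is itself the coefficient of [f_1^2 f_2^2] in the tabulated relation. *)
have D0 : D = 0.
  apply: (@S2_indep_pairs _ _ _ _ indep M _ (rshift 2 0) (rshift 2 1) isT).
  under eq_bigr do rewrite big_mkcond sum_split_ord2 /= !big_ord_recl big_ord0.
  rewrite sum_split_ord2 /= !big_ord_recl big_ord0 /=.
  rewrite !S1fam_E /linform !big_ord_recl !big_ord0 /M /=.
  rewrite -!mul_mpolyC /D -/a0 -/a1 -/b0 -/b1.
  ring.
have offdiag (f : 'I_2 -> Cplx) i j :
    i != j -> f i * f j = f ord0 * f (lift ord0 ord0).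
  case: i j => [[|[|//]] ?] [[|[|//]] ?] // _; last rewrite mulrC;
    by congr (f _ * f _); apply/val_inj.
(* The weights also cancel the coefficient of [z_1^2], and those of [off1] that of [z_2^2]; the
   cross terms are multiples of [D]. *)
have off0 i j : i != j -> b0 ^+ 2 * (a i * a j) + - a0 ^+ 2 * (b i * b j) = 0.
  move=> ij; rewrite !(offdiag _ i j ij) -/a0 -/b0 -/a1 -/b1.
  transitivity (- (a0 * b0 * D)); last by rewrite D0 mulr0 oppr0.
  by rewrite /D; ring.
have off1 i j : i != j -> b1 ^+ 2 * (a i * a j) + - a1 ^+ 2 * (b i * b j) = 0.
  move=> ij; rewrite !(offdiag _ i j ij) -/a0 -/b0 -/a1 -/b1.
  transitivity (a1 * b1 * D); last by rewrite D0 mulr0.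
  by rewrite /D; ring.
have sq0 (x : Cplx) : x ^+ 2 = 0 -> x = 0 by move/eqP; rewrite sqrf_eq0 => /eqP.
have [|/sq0 b00 _] := S2_indep_offdiag (p := ord0) indep off0.
  by rewrite -/a0 -/b0; ring.
have [|/sq0 b10 /eqP] := S2_indep_offdiag (p := lift ord0 ord0) indep off1.
  by rewrite -/a1 -/b1; ring.
rewrite oppr_eq0 sqrf_eq0 => /eqP a10.
(* Since [a1 = 0], [f_1^2] is a multiple of [z_1^2]: a relation free of [z_2^2]. *)
have [||/eqP] := S2_indep_offdiag (s := 1) (t := 0) (p := lift ord0 ord0) indep.
- move=> i j ij; rewrite !(offdiag _ i j ij) -/a1 a10; ring.
- by rewrite -/a1 a10; ring.
by rewrite oner_eq0.
Qed.

Unset Implicit Arguments.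

Theorem theorem1p2 (r : nat) (hr : (2 <= r)%N) (a : 'I_2 -> 'I_r -> Cplx) :
  let S1 := S1fam (linform (a 0)) (linform (a 1)) in
  lin_indep (S2fam S1) <-> lin_indep S1.
Proof.
case: r hr a => [|[|[|r]]] // _ a S1; split; try exact: S1_indep_S2.
  by move/S2_dep_binary.
exact: S2_indep_S1.
Qed.
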